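(* Let $(H,\circ)$ be a $\le$-hypergroupoid and let $I$ be a nonempty subset of $H$. Then $I$ is an ideal of $H$ if and only if the characteristic function $f_I$ is a fuzzy ideal of $H$.
   Context: Let ${\cal P}^*(H)$ denote the set of nonempty subsets of $H$. A hypergroupoid $(H,\circ)$ is a nonempty set $H$ with a hyperoperation $\circ : H\times H\to {\cal P}^*(H)$, $(a,b)\mapsto a\circ b$. It induces an operation $*$ on ${\cal P}^*(H)$ by $A*B=\bigcup_{(a,b)\in A\times B}(a\circ b)$. No associativity is assumed. A $\le$-hypergroupoid is a hypergroupoid $H$ endowed with an arbitrary binary relation denoted $\le$ (not necessarily an order, and not assumed compatible with $\circ$); $b\ge a$ means $a\le b$. A nonempty subset $A$ of a $\le$-hypergroupoid $H$ is a left (resp. right) ideal of $H$ if (1) $H*A\subseteq A$ (resp. $A*H\subseteq A$) and (2) if $a\in A$, $b\in H$ and $b\le a$, then $b\in A$. It is an ideal of $H$ if it is both a left ideal and a right ideal of $H$. A fuzzy subset of $H$ is any mapping $f:H\to[0,1]$. A fuzzy subset $f$ of $H$ is a fuzzy left (resp. fuzzy right) ideal of $H$ if (1) $x\le y$ implies $f(x)\ge f(y)$ for all $x,y\in H$, and (2) for all $x,y\in H$ and all $u\in x\circ y$, $f(u)\ge f(y)$ (resp. $f(u)\ge f(x)$). It is a fuzzy ideal of $H$ if it is both a fuzzy left ideal and a fuzzy right ideal of $H$. For $A\subseteq H$, the characteristic function $f_A:H\to\{0,1\}\subseteq[0,1]$ is given by $f_A(x)=1$ if $x\in A$ and $f_A(x)=0$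 if $x\notin A$. *)

(* Defs.v *)
From mathcomp Require Import all_boot all_order all_algebra.
From mathcomp Require Import boolp classical_sets reals interval_inference.

Set Implicit Arguments.
Unset Strict Implicit.
Unset Printing Implicit Defensive.

Import Order.TTheory GRing.Theory Num.Theory.
Local Open Scope classical_set_scope.
Local Open Scope ring_scope.

Record hypergroupoid := Hypergroupoid {
  hg_sort :> Type;
  hg_nonempty : [set: hg_sort] !=set0;
  hop : hg_sort -> hg_sort -> set hg_sort;
  hop_nonempty : forall a b, hop a b !=set0
}.

(* [hle] is an arbitrary relation: neither an order nor compatible with [hop]. *)
Record le_hypergroupoid := LeHypergroupoid {
  lh_hypergroupoid :> hypergroupoid;
  hle : lh_hypergroupoid -> lh_hypergroupoid -> Prop
}.

(* Defined on all sets; by [hop_nonempty] it restricts to an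
   operation on nonempty sets, the only ones it is applied to below. *)
Definition set_hop (H : hypergroupoid) (A B : set H) : set H :=
  \bigcup_(p in A `*` B) hop p.1 p.2.

Definition left_ideal (H : le_hypergroupoid) (A : set H) : Prop :=
  [/\ A !=set0,
      set_hop [set: H] A `<=` A
    & forall a b : H, A a -> hle b a -> A b].

Definition right_ideal (H : le_hypergroupoid) (A : set H) : Prop :=
  [/\ A !=set0,
      set_hop A [set: H] `<=` A
    & forall a b : H, A a -> hle b a -> A b].

Definition ideal (H : le_hypergroupoid) (A : set H) : Prop :=
  left_ideal A /\ right_ideal A.

Definition fuzzy_subset (R : realType) (H : Type) := H -> {i01 R}.

Definition fuzzy_left_ideal (R : realType) (H : le_hypergroupoid)
    (f : fuzzy_subset R H) : Prop :=
  (forall x y : H, hle x y -> (f x)%:num >= (f y)%:num) /\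
  (forall x y u : H, hop x y u -> (f u)%:num >= (f y)%:num).

Definition fuzzy_right_ideal (R : realType) (H : le_hypergroupoid)
    (f : fuzzy_subset R H) : Prop :=
  (forall x y : H, hle x y -> (f x)%:num >= (f y)%:num) /\
  (forall x y u : H, hop x y u -> (f u)%:num >= (f x)%:num).

Definition fuzzy_ideal (R : realType) (H : le_hypergroupoid)
    (f : fuzzy_subset R H) : Prop :=
  fuzzy_left_ideal f /\ fuzzy_right_ideal f.

Definition char_fun (R : realType) (H : Type) (A : set H) : fuzzy_subset R H :=
  fun x => if x \in A then 1%:i01 else 0%:i01.

(* Main.v *)
Require Import Defs.
From mathcomp Require Import all_boot all_order all_algebra.
From mathcomp Require Import boolp classical_sets reals interval_inference.
Local Open Scope classical_set_scope.

(** A characteristic function takes only the values 0 and 1, so an inequality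
    between two of its values is an implication between memberships
    ([char_fun_leP]). Under this dictionary each clause defining a fuzzy ideal
    turns into a closure clause defining an ideal: monotonicity becomes
    downward closure, and the bound on the values over [hop x y] becomes
    absorption of products by the whole carrier. Left clauses match left
    clauses and right ones match right ones, so the two sides never interact. *)

Lemma char_fun_leP (R : realType) (T : Type) (A : set T) (x y : T) :
  ((char_fun R A x)%:num <= (char_fun R A y)%:num)%R <-> (A x -> A y).
Proof.
rewrite /char_fun; case: ifPn => [/set_mem Ax|/negP nAx];
  case: ifPn => [/set_mem Ay|/negP nAy] /=; split => //.
- by rewrite Num.Theory.ler10.
- by move=> /(_ Ax) /mem_set.
- by move=> _ /mem_set.
Qed.

Lemma left_ideal_char_fun (R : realType) (H : le_hypergroupoid) (A : set H) :
  A !=set0 -> left_ideal A <-> fuzzy_left_ideal (char_fun R A).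
Proof.
move=> A0; split=> [[_ mulA downA]|[monoA mulA]].
- split=> [x y xy|x y u xyu]; apply/char_fun_leP => Ay; first exact: downA xy.
  by apply: mulA; exists (x, y).
- split=> // [u [[x y] /= [_ Ay] xyu]|a b Aa ba].
    by have /char_fun_leP := mulA _ _ _ xyu; apply.
  by have /char_fun_leP := monoA _ _ ba; apply.
Qed.

Lemma right_ideal_char_fun (R : realType) (H : le_hypergroupoid) (A : set H) :
  A !=set0 -> right_ideal A <-> fuzzy_right_ideal (char_fun R A).
Proof.
move=> A0; split=> [[_ mulA downA]|[monoA mulA]].
- split=> [x y xy|x y u xyu]; apply/char_fun_leP => Ax; first exact: downA xy.
  by apply: mulA; exists (x, y).
- split=> // [u [[x y] /= [Ax _] xyu]|a b Aa ba].
    by have /char_fun_leP := mulA _ _ _ xyu; apply.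
  by have /char_fun_leP := monoA _ _ ba; apply.
Qed.

Theorem proposition8 (R : realType) (H : le_hypergroupoid) (I : set H)
    (I_nonempty : I !=set0) :
  ideal I <-> fuzzy_ideal (char_fun R I).
Proof.
have lI := left_ideal_char_fun R _ _ I_nonempty.
have rI := right_ideal_char_fun R _ _ I_nonempty.
by split=> -[/lI ? /rI ?].
Qed.
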